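(* Let $(\bar{S},\bar{D})$ be an $(N+1)$-dimensional securities market model that is instantaneously arbitrage-free. If $\bar{b}_{1}$ and $\bar{b}_{2}$ are money market accounts for $(\bar S,\bar D)$ with interest rate processes $r_{1}$ and $r_{2}$ and value processes $M_{1}$ and $M_{2}$, then $r_{1}$ and $r_{2}$ are almost everywhere identical, and $M_{1}/M_{1}(0)$ and $M_{2}/M_{2}(0)$ are indistinguishable.
   Context: Setting: $(\Omega,\mathcal{F},P)$ is a complete probability space with a filtration $\{\mathcal{F}_t\}_{t\in\mathcal{T}}$, where $\mathcal{T}$ is the time interval ($[0,T]$ or $[0,\infty)$), and $W$ is a $K$-dimensional Wiener process relative to the filtration. ''Measurable'' process means jointly measurable on $\Omega\times\mathcal{T}$; ''almost everywhere'' and ''positive measure'' refer to the product of $P$ and Lebesgue measure on $\Omega\times\mathcal{T}$. $\mathcal{L}^1$ (resp. $\mathcal{L}^2$) is the set of adapted, measurable, pathwise integrable (resp. pathwise square integrable) processes (over each $[0,t]$, $t\in\mathcal T$). Time integrals and stochastic integrals of such processes are understood to be continuous adapted processes, and equality of such processes is up to indistinguishability. Securities market model: a pair $(\bar S,\bar D)$ of adapted measurable $(N+1)$-dimensional (column vector) processes (prices and cumulative dividends) with $\bar D(0)=0$ such that $\bar G=\bar S+\bar D$ is an Itô process: $\bar G(t)=\bar G(0)+\int_0^t\bar\mu\,ds+\int_0^t\bar\sigma\,dW$, with $\bar\mu$ an $(N+1)$-dimensional process in $\mathcal{L}^1$ and $\bar\sigma$ an $(N+1)\times K$ matrix-valued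 process in $\mathcal{L}^2$. A trading strategy is an adapted, measurable $(N+1)$-dimensional row-vector-valued process $\bar\Delta$; its value process is $\bar\Delta\bar S$. $\mathcal{L}(\bar G)$ is the set of trading strategies with $\bar\Delta\bar\mu\in\mathcal{L}^1$, $\bar\Delta\bar\sigma\in\mathcal{L}^2$. A trading strategy $\bar\Delta\in\mathcal{L}(\bar G)$ is self-financing if $\bar\Delta(t)\bar S(t)=\bar\Delta(0)\bar S(0)+\int_0^t\bar\Delta\,d\bar G$ for all $t$. A money market account is a self-financing trading strategy $\bar b$ whose value process $M=\bar b\bar S$ is positive and instantaneously riskless (zero dispersion, i.e. zero $dW$-coefficient). Then $M(t)=M(0)\exp\{\int_0^t r\,ds\}$ for some $r\in\mathcal{L}^1$, the interest rate process. A trading strategy $\bar\Delta$ is instantaneously riskless if $\bar\Delta\bar\sigma=0$ almost everywhere. A zero-value instantaneous arbitrage trading strategy is an instantaneously riskless trading strategy $\bar\Delta$ such that $\bar\Delta\bar S=0$ almost everywhere, $\bar\Delta\bar\mu\ge 0$ almost everywhere, and $\bar\Delta\bar\mu>0$ on a set of positive measure. $(\bar S,\bar D)$ is instantaneously arbitrage-free if there exists no zero-value instantaneous arbitrage trading strategy. *)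

(* Defs.v *)
From HB Require Import structures.
From mathcomp Require Import all_boot all_order all_algebra.
From mathcomp Require Import all_classical all_reals all_analysis.
Set Implicit Arguments.
Unset Strict Implicit.
Unset Printing Implicit Defensive.
Import Order.TTheory GRing.Theory Num.Theory.
Import numFieldNormedType.Exports.
Local Open Scope classical_set_scope.
Local Open Scope ring_scope.

(* Conventions.  A process is a function [time -> Omega -> values]; time is all
   of R, but only the times in the time interval T matter.  Pathwise properties
   of processes are required P-almost surely (outside one null set that does not
   depend on time). *)

Definition time_interval (R : realType) (T : set R) : Prop :=
  (exists2 tau : R, 0 < tau & T = `[0, tau]%classic) \/ T = `[0, +oo[%classic.

Definition filtration d (Omega : measurableType d) (R : realType) (T : set R)
    (F : R -> set_system Omega) : Prop :=
  [/\ forall t, T t -> sigma_algebra setT (F t),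
      forall t, T t -> F t `<=` measurable &
      forall s t, T s -> T t -> s <= t -> F s `<=` F t].

Definition rv_measurable d (Omega : measurableType d) (R : realType)
    (G : set_system Omega) (X : Omega -> R) : Prop :=
  forall B : set R, measurable B -> G (X @^-1` B).

(* [entrywise Pr X]: every entry of the matrix-valued process X satisfies Pr. *)
Definition entrywise (Omega : Type) (R : realType) m n
    (Pr : (R -> Omega -> R) -> Prop) (X : R -> Omega -> 'M[R]_(m, n)) : Prop :=
  forall i j, Pr (fun t w => X t w i j).

Section processes.
Context d (Omega : measurableType d) (R : realType).
Variables (P : probability Omega R) (T : set R) (F : R -> set_system Omega).
Implicit Types X Y : R -> Omega -> R.

Local Notation leb := (@lebesgue_measure R).

Definition adapted X : Prop := forall t, T t -> rv_measurable (F t) (X t).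

Definition measurable_process X : Prop :=
  measurable_fun ([set: Omega] `*` T) (fun p : Omega * R => X p.2 p.1).

Definition continuous_process X : Prop :=
  \forall w \ae P, {within T, continuous (fun t => X t w)}.

Definition indistinguishable X Y : Prop :=
  \forall w \ae P, forall t, T t -> X t w = Y t w.

Definition ae_process (Q : R -> Omega -> Prop) : Prop :=
  \forall p \ae (P \x leb)%E, T p.2 -> Q p.2 p.1.

Definition positive_measure (Q : R -> Omega -> Prop) : Prop :=
  (0 < (P \x leb) [set p : Omega * R | T p.2 /\ Q p.2 p.1])%E.

Definition L1 X : Prop :=
  [/\ adapted X, measurable_process X &
      \forall w \ae P, forall t, T t -> leb.-integrable `[0, t]%classic (fun s => (X s w)%:E)].

Definition L2 X : Prop :=
  [/\ adapted X, measurable_process X &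
      \forall w \ae P, forall t, T t ->
        (\int[leb]_(s in `[0%R, t]) (X s w ^+ 2)%:E < +oo)%E].

Definition time_integral X Y : Prop :=
  [/\ adapted Y, continuous_process Y &
      indistinguishable Y (fun t w => \int[leb]_(s in `[0, t]) X s w)].

End processes.

Section ito.
Context d (Omega : measurableType d) (R : realType) (K : nat).
Variables (P : probability Omega R) (T : set R) (F : R -> set_system Omega).
Variable W : R -> Omega -> 'cV[R]_K.

Local Notation leb := (@lebesgue_measure R).

(* The product formula says that, for s < t, the increment W t - W s is
   independent of F s and that its K coordinates are independent, centred
   Gaussian with variance t - s ([normal_prob] takes the standard deviation). *)
Definition wiener_process : Prop :=
  [/\ entrywise (adapted T F) W,
      entrywise (continuous_process P T) W,
      \forall w \ae P, W 0 w = 0 &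
      forall s t, T s -> T t -> s < t ->
      forall A, F s A ->
      forall B : 'I_K -> set R, (forall j, measurable (B j)) ->
        P (A `&` [set w | forall j, B j ((W t w - W s w) j 0)]) =
        (P A * \prod_(j < K) normal_prob 0%R (Num.sqrt (t - s)%R) (B j))%E].

(* Row-valued simple process
     sum_(k < size) coef_k * 1_{]node_k, node_(k+1)]}
   with coef_k bounded and F_(node_k)-measurable. *)
Record simple_process := SimpleProcess {
  sp_size : nat;
  sp_node : nat -> R;
  sp_coef : nat -> Omega -> 'rV[R]_K;
  sp_node_in : forall k, (k <= sp_size)%N -> T (sp_node k);
  sp_node_lt : forall k, (k < sp_size)%N -> sp_node k < sp_node k.+1;
  sp_coef_measurable : forall k j, (k < sp_size)%N ->
    rv_measurable (F (sp_node k)) (fun w => sp_coef k w 0 j);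
  sp_coef_bounded : exists C : R, forall k w j, (k < sp_size)%N ->
    `|sp_coef k w 0 j| <= C
}.

Definition sp_val (H : simple_process) (t : R) (w : Omega) : 'rV[R]_K :=
  \sum_(k < sp_size H)
    (\1_(`]sp_node H k, sp_node H k.+1] : set R) t : R) *: sp_coef H k w.

Definition sp_integral (H : simple_process) (t : R) (w : Omega) : R :=
  \sum_(k < sp_size H)
    (sp_coef H k w *m (W (Num.min (sp_node H k.+1) t) w
                       - W (Num.min (sp_node H k) t) w)) 0 0.

(* int_0^t |H_n - H|^2 ds -> 0 in probability, for every t in T. *)
Definition simple_approx (H : R -> Omega -> 'rV[R]_K)
    (Hn : nat -> simple_process) : Prop :=
  forall t, T t -> forall e : R, 0 < e ->
    (fun n => P [set w | e%:E <
       \int[leb]_(s in `[0%R, t])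
          (\sum_(j < K) ((sp_val (Hn n) s w - H s w) ord0 j) ^+ 2)%R%:E]%E)
      @ \oo --> 0%E.

(* sup_(s <= t) |X_n s - X s| -> 0 in probability, for every t in T. *)
Definition ucp_cvg (Xn : nat -> R -> Omega -> R) (X : R -> Omega -> R) : Prop :=
  forall t, T t -> forall e : R, 0 < e ->
    (fun n => P [set w | exists2 s, s \in `[0, t] & e < `|Xn n s w - X s w|])
      @ \oo --> 0%E.

(* I is (a version of) the process int_0^t H dW, H pathwise square integrable:
   the limit of the integrals of the simple processes that approximate H,
   which does not depend on the approximating sequence. *)
Definition stochastic_integral (H : R -> Omega -> 'rV[R]_K)
    (I : R -> Omega -> R) : Prop :=
  [/\ adapted T F I, continuous_process P T I,
      exists Hn, simple_approx H Hn &
      forall Hn, simple_approx H Hn -> ucp_cvg (fun n => sp_integral (Hn n)) I].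

(* X t = X 0 + int_0^t a ds + int_0^t s dW. *)
Definition ito_process (X a : R -> Omega -> R) (s : R -> Omega -> 'rV[R]_K)
    : Prop :=
  [/\ L1 P T F a, entrywise (L2 P T F) s &
      exists A I, [/\ time_integral P T F a A, stochastic_integral s I &
        indistinguishable P T X (fun t w => X 0 w + A t w + I t w)]].

End ito.

Section market.
Context d (Omega : measurableType d) (R : realType) (K N : nat).
Variables (P : probability Omega R) (T : set R) (F : R -> set_system Omega).
Variable W : R -> Omega -> 'cV[R]_K.
Variables S D mu : R -> Omega -> 'cV[R]_N.+1.
Variable sigma : R -> Omega -> 'M[R]_(N.+1, K).
Implicit Type Delta : R -> Omega -> 'rV[R]_N.+1.

(* mu and sigma are the coefficients of the cumulative gains process S + D. *)
Definition securities_market_model : Prop :=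
  [/\ entrywise (adapted T F) S /\ entrywise (measurable_process T) S,
      entrywise (adapted T F) D /\ entrywise (measurable_process T) D,
      \forall w \ae P, D 0 w = 0 &
      forall i, ito_process P T F W (fun t w => (S t w + D t w) i 0)
                  (fun t w => mu t w i 0) (fun t w => row i (sigma t w))].

Definition trading_strategy Delta : Prop :=
  entrywise (adapted T F) Delta /\ entrywise (measurable_process T) Delta.

Definition value_process Delta : R -> Omega -> R :=
  fun t w => (Delta t w *m S t w) 0 0.

Definition gains_drift Delta : R -> Omega -> R :=
  fun t w => (Delta t w *m mu t w) 0 0.

Definition gains_dispersion Delta : R -> Omega -> 'rV[R]_K :=
  fun t w => Delta t w *m sigma t w.

Definition in_LG Delta : Prop :=
  [/\ trading_strategy Delta, L1 P T F (gains_drift Delta) &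
      entrywise (L2 P T F) (gains_dispersion Delta)].

Definition self_financing Delta : Prop :=
  in_LG Delta /\
  ito_process P T F W (value_process Delta)
    (gains_drift Delta) (gains_dispersion Delta).

Definition instantaneously_riskless Delta : Prop :=
  trading_strategy Delta /\
  ae_process P T (fun t w => gains_dispersion Delta t w = 0).

(* For a self-financing b, d(b S) = b mu dt + b sigma dW: the dispersion of the
   value process is b sigma. *)
Definition money_market_account b : Prop :=
  [/\ self_financing b,
      \forall w \ae P, forall t, T t -> 0 < value_process b t w &
      instantaneously_riskless b].

Definition interest_rate_process b (r : R -> Omega -> R) : Prop :=
  L1 P T F r /\
  exists2 A, time_integral P T F r A &
    indistinguishable P T (value_process b)
      (fun t w => value_process b 0 w * expR (A t w)).

Definition zero_value_inst_arbitrage Delta : Prop :=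
  [/\ instantaneously_riskless Delta,
      ae_process P T (fun t w => value_process Delta t w = 0),
      ae_process P T (fun t w => 0 <= gains_drift Delta t w) &
      positive_measure P T (fun t w => 0 < gains_drift Delta t w)].

Definition inst_arbitrage_free : Prop :=
  ~ exists Delta, zero_value_inst_arbitrage Delta.

End market.

(* Main.v *)
(* The dispersion of M_i = b_i S vanishes, and so does its stochastic integral,
   since the zero simple process approximates the integrand.  Hence, pathwise,
   M_i(t) = M_i(0) + int_0^t b_i mu = M_i(0) exp (int_0^t r_i), and
   differentiating at Lebesgue points gives b_i mu = r_i M_i almost everywhere.
   The strategy (r_1 - r_2) (M_2 b_1 - M_1 b_2) is riskless, has value 0 and
   drift (r_1 - r_2)^2 M_1 M_2 >= 0, so absence of arbitrage forces r_1 = r_2. *)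
Require Import Defs.
From HB Require Import structures.
From mathcomp Require Import all_boot all_order all_algebra.
From mathcomp Require Import all_classical all_reals all_analysis measurable_realfun ring.
Import Order.TTheory GRing.Theory Num.Theory.
Import numFieldNormedType.Exports.
Local Open Scope classical_set_scope.
Local Open Scope ring_scope.

(** * Almost-everywhere statements and null sets of a product measure *)

Lemma aeI {d : measure_display} {V : measurableType d} {R : realType}
    {mu : {measure set V -> \bar R}} {A B : V -> Prop} :
  (\forall x \ae mu, A x) -> (\forall x \ae mu, B x) ->
  \forall x \ae mu, A x /\ B x.
Proof. exact: (@filterI _ _ (ae_filter_ringOfSetsType mu)). Qed.

Lemma aeS {d : measure_display} {V : measurableType d} {R : realType}
    {mu : {measure set V -> \bar R}} {A B : V -> Prop} :
  (forall x, A x -> B x) -> (\forall x \ae mu, A x) -> \forall x \ae mu, B x.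
Proof. exact: (@filterS _ _ (ae_filter_ringOfSetsType mu)). Qed.

Section product_null_sets.
Context {d1 d2 : measure_display} {T1 : measurableType d1}
  {T2 : measurableType d2} {R : realType}.
Context (m1 : {measure set T1 -> \bar R})
  (m2 : {sigma_finite_measure set T2 -> \bar R}).

(** Tonelli: the product measure of [A] is the integral of the measures of its sections, and a
    nonnegative function has integral zero exactly when it vanishes almost everywhere. *)
Lemma product_measure_eq0P (A : set (T1 * T2)) : measurable A ->
  (m1 \x m2)%E A = 0%E <-> \forall x \ae m1, m2 (xsection A x) = 0%E.
Proof.
move=> mA.
have mf := measurable_fun_xsection m2 mA.
have -> : (m1 \x m2)%E A = (\int[m1]_x `|(m2 \o xsection A) x|)%E.
  by apply: eq_integral => x _; rewrite gee0_abs.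
split=> [/(ae_eq_integral_abs m1 measurableT mf)|h].
  by apply: aeS => x; apply.
by apply/(ae_eq_integral_abs m1 measurableT mf); apply: aeS h.
Qed.

Lemma ae_product_xsection (Q : T1 -> T2 -> Prop) :
  (\forall p \ae (m1 \x m2)%E, Q p.1 p.2) ->
  \forall x \ae m1, \forall y \ae m2, Q x y.
Proof.
move=> [A [mA /(product_measure_eq0P _ mA) A0 QA]].
apply: aeS A0 => x Ax0; exists (xsection A x).
split; [exact: measurable_xsection|exact: Ax0|].
by move=> y Qxy; apply/xsectionP; exact: QA.
Qed.

(** Null sections control the product measure only of a measurable set, hence the joint
    measurability asked of [Q], in contrast with the converse direction above. *)
Lemma ae_product_of_xsection (Q : T1 -> T2 -> Prop) :
  measurable [set p : T1 * T2 | Q p.1 p.2] ->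
  (\forall x \ae m1, \forall y \ae m2, Q x y) ->
  \forall p \ae (m1 \x m2)%E, Q p.1 p.2.
Proof.
move=> mQ aeQ; have mA := measurableC mQ.
exists (~` [set p | Q p.1 p.2]); split => //.
apply/(product_measure_eq0P _ mA); apply: aeS aeQ => x Qx.
apply: measure_negligible; first exact: measurable_xsection.
by apply: negligibleS Qx => y /xsectionP.
Qed.

End product_null_sets.

(** * Differentiation of indefinite integrals at Lebesgue points *)

Section FTC_bounded_interval.
Context {R : realType}.
Local Notation leb := (@lebesgue_measure R).

(** Lebesgue differentiation wants a locally integrable function on the whole line, so [f] is cut
    off outside [[0, b]]. At an interior Lebesgue point the fundamental theorem applies to the
    cut-off, whose primitive agrees with [F] nearby. *)
Lemma is_derive_Rintegral_ae (f : R -> R) (b : R) :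
  leb.-integrable `[0, b] (EFin \o f) ->
  let F (y : R) := \int[leb]_(s in `[0, y]) f s in
  \forall x \ae leb, x \in `]0, b[ -> is_derive x 1 F (f x).
Proof.
move=> intf F; set g := f \_ `[0, b].
have gf (y : R) : y \in `[0, b] -> g y = f y by move=> yb; rewrite /g patchE mem_set.
have intg : leb.-integrable `[0, b] (EFin \o g).
  by apply: eq_integrable intf => //= y /set_mem/gf ->.
have := lebesgue_differentiation (integrable_locally (measurable_itv _) intf).
apply: aeS => x gx x0b; have /andP[x0 xb] := x0b.
have [dG G'] := FTC1_lebesgue_pt xb intg x0 gx.
have x0b' : x \in `[0, b] by exact: subset_itv_oo_cc.
set G := (X in derivable X _ _) in dG; rewrite derive1E (gf _ x0b') in G'.
have GF : \forall y \near x, G y = F y.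
  near=> y; apply: eq_Rintegral => z /set_mem /=; rewrite in_itv/= => /andP[z0 zy].
  apply: gf; rewrite in_itv/= z0/= (le_trans zy)//.
  have : y \in `]0, b[ by near: y; exact: near_in_itvoo.
  by rewrite in_itv/= => /andP[_ /ltW].
exact: near_eq_is_derive GF (DeriveDef dG G').
Unshelve. all: by end_near. Qed.

(** Both sides of the identity agree near every interior point, so their derivatives agree wherever
    both integrals are differentiable; the chain rule computes the left one. *)
Lemma expR_Rintegral_ae (f g : R -> R) (c b : R) :
  leb.-integrable `[0, b] (EFin \o f) ->
  leb.-integrable `[0, b] (EFin \o g) ->
  (forall t, t \in `]0, b[ -> c * expR (\int[leb]_(s in `[0, t]) f s) =
                             c + \int[leb]_(s in `[0, t]) g s) ->
  \forall x \ae leb, x \in `]0, b[ ->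
    g x = c * expR (\int[leb]_(s in `[0, x]) f s) * f x.
Proof.
move=> /is_derive_Rintegral_ae intf /is_derive_Rintegral_ae intg fg.
apply: aeS (aeI intf intg) => x [df dg] x0b.
have {}df := df x0b; have {}dg := dg x0b.
have dE := is_deriveZ c (is_derive1_comp (is_derive_expR _) df).
have dc := is_deriveD (is_derive_cst c x 1) dg.
set E := (X in is_derive _ _ X _) in dE; set C := (X in is_derive _ _ X _) in dc.
have EC : \forall y \near x, E y = C y.
  near=> y; apply: fg; by near: y; exact: near_in_itvoo.
have [_ {}dE] := near_eq_is_derive EC dE; have [_ {}dc] := dc.
by move: dE; rewrite dc add0r => ->; rewrite -mulrA.
Unshelve. all: by end_near. Qed.
End FTC_bounded_interval.

(** * The time interval and its exhaustion by compact intervals *)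

Section time.
Context {R : realType} {T : set R} (hT : time_interval T).
Local Notation leb := (@lebesgue_measure R).

Lemma time_interval0 : T 0.
Proof.
by case: hT => [[tau tau0 ->]|->] /=; rewrite in_itv/= lexx//= ltW.
Qed.

Lemma time_interval_sub {t : R} : T t -> `[0, t] `<=` T.
Proof.
case: hT => [[tau _ ->]|->] /=; rewrite in_itv/= => /andP[t0 tT] s;
  rewrite /= !in_itv/= => /andP[-> st]//=.
exact: le_trans tT.
Qed.

Lemma measurable_time_interval : measurable T.
Proof. by case: hT => [[tau _ ->]|->]; exact: measurable_itv. Qed.

(** Reduces claims about all of [T] to countably many intervals, so that the union of their
    exceptional sets is still null. *)
Lemma time_interval_exhaustion : exists u : R^nat,
  (forall n, 0 < u n /\ T (u n)) /\ (forall t, T t -> exists n, t \in `[0, u n]).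
Proof.
case: hT => [[tau tau0 ->]|->].
  exists (fun=> tau); split=> [n|t]; last by exists 0%N.
  by split; rewrite //= in_itv/= lexx ltW.
exists (fun n => n.+1%:R); split=> [n|t].
  by split; rewrite //= in_itv/= ler0n.
rewrite /= in_itv/= andbT => t0; exists (Num.truncn t).
by rewrite in_itv/= t0/= ltW// truncnS_gt.
Qed.

(** The only times that can be missed are 0 and the right endpoints [u n], a countable set. *)
Lemma time_interval_interior_ae (u : R^nat) :
  (forall t, T t -> exists n, t \in `[0, u n]) ->
  \forall t \ae leb, T t -> exists n, t \in `]0, u n[.
Proof.
move=> Tu; suff : leb.-negligible ([set 0] `|` range u).
  apply: negligibleS.
  move=> t /= /not_implyP[/Tu[n]]; rewrite in_itv/= => /andP[t0 tn] tu.
  apply: contrapT => /not_orP[/eqP tn0 /= tun]; apply: tu; exists n.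
  rewrite in_itv/= lt_neqAle eq_sym tn0 t0 lt_neqAle tn/= !andbT.
  by apply/eqP => tE; apply: tun; exists n.
apply: negligibleU; first by apply/negligibleP => //; exact: lebesgue_measure_set1.
have cu : countable (range u) by exact: card_le_trans (card_image_le _ _) (countableP _).
apply/negligibleP; last exact: countable_lebesgue_measure0.
exact: countable_measurable.
Qed.

End time.

(** The strict inequality persists on a relative neighbourhood of [s]. Since [0 < t], this
    neighbourhood meets the open interval even when [s] is an endpoint, and so contains a
    rational. *)
Lemma within_itv_rat_witness {R : realType} {f : R -> R} {t s e : R} :
  0 < t -> {within `[0, t], continuous f} -> s \in `[0, t] -> e < `|f s| ->
  exists2 q : rat, ratr q \in `]0, t[ & e < `|f (ratr q)|.
Proof.
move=> t0 /subspace_continuousP cf st es.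
have [r r0 sre] := cvgr_gt _ (cvg_norm (cf s st)) _ es.
have /andP[s0 s1] : (0 <= s) && (s <= t) by move: st; rewrite in_itv.
have [|q] := @rat_in_itvoo R (Num.max 0 (s - r)) (Num.min t (s + r)).
  rewrite gt_max !lt_min t0 -/(0 < s + r) ltr_wpDl//= ltrBlDr.
  by rewrite ltr_pwDr//= ltrD2l gtrN.
rewrite in_itv/= gt_max lt_min => /andP[/andP[q0 sq] /andP[qt qs]].
exists q; first by rewrite in_itv/= q0.
apply: sre; rewrite /= ?in_itv/= ?(ltW q0) ?(ltW qt)//.
by rewrite ltr_distlC sq.
Qed.

(** Off a null set [A], [C] coincides with [D]; the rest of [C] lies inside [A] and is measurable by
    completeness. *)
Lemma complete_ae_measurable {d : measure_display} {Omega : measurableType d}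
    {R : realType} (P : {measure set Omega -> \bar R}) (C D : set Omega) :
  measure_is_complete P -> measurable D -> (\forall w \ae P, C w <-> D w) ->
  measurable C.
Proof.
move=> hP mD [A [mA A0 CDA]].
have -> : C = (D `\` A) `|` (C `&` A).
  apply/seteqP; split=> w.
    move=> Cw; have [Aw|nAw] := pselect (A w); first by right.
    by left; split => //; have /contrapT [CD _] := contra_not (CDA w) nAw; exact: CD.
  case=> [[Dw nAw]|[]//].
  by have /contrapT [_ CD] := contra_not (CDA w) nAw; exact: CD.
apply: measurableU; first exact: measurableD.
by apply: hP; exists A; split => // w [].
Qed.

(** Makes the closure properties of [measurable_fun] available for measurability with respect to a
    single [F t]. *)
Lemma rv_measurable_fun {d : measure_display} {Omega : measurableType d}
    {R : realType} (G : set_system Omega) (X : Omega -> R) :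
  sigma_algebra setT G ->
  rv_measurable G X <-> measurable_fun setT (X : g_sigma_algebraType G -> R).
Proof.
move=> sG; have GE := measurable_g_measurableTypeE sG.
split=> [mX _ B mB|mX B mB].
  by rewrite setTI; have := mX B mB; rewrite -[X in X _]GE.
by have := mX measurableT B mB; rewrite setTI -[X in _ -> X _]GE.
Qed.

(** * Continuous processes and the stochastic integral of a null integrand *)

Section processes.
Context {d : measure_display} {Omega : measurableType d} {R : realType}
  {P : probability Omega R} (hP : measure_is_complete P)
  {T : set R} (hT : time_interval T)
  {F : R -> set_system Omega} (hF : filtration T F).
Local Notation leb := (@lebesgue_measure R).

Lemma measurable_process_path (X : R -> Omega -> R) (w : Omega) :
  measurable_process T X -> measurable_fun T (X ^~ w).
Proof.
move=> mX; have mT := measurable_time_interval hT.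
apply: (measurable_comp (F := [set: Omega] `*` T) (g := pair w)
  (f := fun p => X p.2 p.1)) => //.
- exact: measurableX.
- by move=> _ [t Tt <-].
- exact: measurable_funTS (pair1_measurable w).
Qed.

(* P takes junk values on non-measurable sets, so [ucp_cvg] is only usable once
   its supremum events are known to be measurable; by path continuity they
   agree almost surely with a countable union over rational times. *)
Lemma measurable_sup_norm {X : R -> Omega -> R} {t : R} (e : R) :
  adapted T F X -> continuous_process P T X -> T t -> 0 < t ->
  measurable [set w | exists2 s, s \in `[0, t] & e < `|X s w|].
Proof.
move=> aX cX Tt t0; have tT := time_interval_sub hT Tt.
apply: (complete_ae_measurable P _ (\bigcup_(q : rat)
    [set w | (ratr q \in `]0, t[) && (e < `|X (ratr q) w|)])) => //.
  apply: countable_bigcupT_measurable => // q.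
  have [qt|_] /= := boolP (ratr q \in `]0, t[); last first.
    by rewrite [X in measurable X](_ : _ = set0)//; apply/seteqP; split.
  have Tq : T (ratr q) by apply: tT; exact: subset_itv_oo_cc.
  have [_ Fm _] := hF; apply: (Fm _ Tq).
  apply: (aX _ Tq [set x | e < `|x|]).
  have -> : [set x : R | e < `|x|] = setT `&` Num.norm @^-1` `]e, +oo[.
    by rewrite setTI; apply/funext => x /=; rewrite in_itv/= andbT.
  have mnorm : measurable_fun [set: R] (@Num.norm _ R) by [].
  exact: mnorm.
apply: aeS cX => w cXw; split=> [[s st es]|[q _ /=/andP[qt eq]]].
  have [q qt eq] := within_itv_rat_witness t0 (continuous_subspaceW tT cXw) st es.
  by exists q => //=; rewrite qt.
by exists (ratr q) => //; exact: subset_itv_oo_cc.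
Qed.

(** The approximating sequence is constant, so the probabilities in [ucp_cvg] do not depend on the
    index and must already be 0. Countably many events, one per interval and threshold 1/(k+1), then
    cover all paths that leave 0. *)
Lemma ucp_limit0 (X : R -> Omega -> R) :
  adapted T F X -> continuous_process P T X ->
  ucp_cvg P T (fun=> fun _ _ => 0) X -> indistinguishable P T X (fun _ _ => 0).
Proof.
move=> aX cX X0; have [u [uT Tu]] := time_interval_exhaustion hT.
have null n k : \forall w \ae P,
    ~ exists2 s, s \in `[0, u n] & k.+1%:R^-1 < `|X s w|.
  have [un0 Tun] := uT n.
  have mC := measurable_sup_norm (k.+1%:R^-1) aX cX Tun un0.
  rewrite /prop_near1/= /nbhs/= /almost_everywhere.
  rewrite (_ : ~` _ = [set w | exists2 s, s \in `[0, u n] & k.+1%:R^-1 < `|X s w|]).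
    apply/negligibleP => //.
    have k0 : 0 < k.+1%:R^-1 :> R by rewrite invr_gt0.
    have := X0 _ Tun _ k0.
    rewrite (_ : [set w | _] = [set w | exists2 s, s \in `[0, u n] & k.+1%:R^-1 < `|X s w|]).
      by move/(cvg_unique (@ereal_hausdorff R)) => /(_ _ (cvg_cst _)).
    by apply/seteqP; split=> w [s st] es; exists s; rewrite // ?sub0r ?normrN// in es *.
  by apply/seteqP; split=> w /=; [exact: contrapT|move=> ? []].
have : \forall w \ae P, forall n k,
    ~ exists2 s, s \in `[0, u n] & k.+1%:R^-1 < `|X s w|.
  by apply: ae_foralln => n; apply: ae_foralln => k; exact: null.
apply: aeS => w Xw t /Tu[n tn]; apply: contrapT => /eqP Xt0.
(* With k the integer part of 1/|X t w|, 1/(k+1) is strictly below |X t w|. *)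
apply: (Xw n (Num.truncn `|X t w|^-1)); exists t => //.
by rewrite invf_plt ?posrE ?normr_gt0// truncnS_gt.
Qed.

Lemma empty_simple_process {K : nat} :
  exists H : simple_process K T F, sp_size H = 0%N.
Proof.
unshelve eexists (@SimpleProcess _ Omega R K T F 0 (fun=> 0) (fun _ _ => 0) _ _ _ _) => //.
(* Even with no steps, [sp_node_in] constrains node 0; the constant node 0 lies in [T]. *)
- by move=> k _; exact: time_interval0.
- by exists 0.
Qed.

(** The constant sequence of empty simple processes approximates [H], and its integrals are
    identically 0, so [ucp_limit0] applies to the limit [I]. *)
Lemma stochastic_integral_ae0 {K : nat} (W : R -> Omega -> 'cV[R]_K)
    (H : R -> Omega -> 'rV[R]_K) (I : R -> Omega -> R) :
  entrywise (measurable_process T) H ->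
  ae_process P T (fun t w => H t w = 0) ->
  stochastic_integral P T F W H I ->
  indistinguishable P T I (fun _ _ => 0).
Proof.
move=> mH H0 [aI cI _ limI]; apply: ucp_limit0 => //.
have [Z Z0] := @empty_simple_process K.
have ZI t w : sp_integral W Z t w = 0.
  by rewrite /sp_integral big1// => -[i]; rewrite Z0.
have Zv t w : sp_val Z t w = 0.
  by rewrite /sp_val big1// => -[i]; rewrite Z0.
suff /limI : simple_approx P H (fun=> Z).
  by rewrite (_ : (fun=> sp_integral W Z) = fun=> fun _ _ => 0)//;
    apply/funext => n; apply/funext => t; apply/funext => w; exact: ZI.
move=> t Tt e e0; rewrite (_ : (fun=> _) = cst 0%E); first exact: cvg_cst.
apply/funext => n /=.
suff : \forall w \ae P, ~ (e%:E < \int[leb]_(s in `[0%R, t])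
    (\sum_(j < K) ((sp_val Z s w - H s w) ord0 j) ^+ 2)%R%:E)%E.
  move=> nE; have {}nE : P.-negligible [set w | (e%:E < \int[leb]_(s in `[0%R, t])
    (\sum_(j < K) ((sp_val Z s w - H s w) ord0 j) ^+ 2)%R%:E)%E].
    by apply: negligibleS nE => w Ew /=; apply.
  (* Negligibility yields [P] = 0 only for a measurable event; completeness supplies the
     measurability. *)
  by apply: (measure_negligible (mu := P) (hP _ nE) nE).
(* By Tonelli, almost every path of [H] vanishes at almost all times, so its squared distance to the
   zero process integrates to 0. *)
have := @ae_product_xsection _ _ _ _ _ P leb (fun w s => T s -> H s w = 0) H0.
apply: aeS => w Hw0; rewrite (ae_eq_integral (cst 0%E)) ?integral0//.
- by apply/negP; rewrite -leNgt lee_fin ltW.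
- apply/measurable_EFinP; apply: measurable_sum => j.
  apply: measurable_funX.
  rewrite (_ : (fun s => _) = fun s => - H s w ord0 j); last first.
    by apply/funext => s; rewrite Zv sub0r mxE.
  apply: measurableT_comp => //.
  apply: (measurable_funS (measurable_time_interval hT) (time_interval_sub hT Tt)).
  exact: (measurable_process_path (fun t w => H t w ord0 j)).
- apply: aeS Hw0 => s Hs0 st.
  rewrite big1// => j _.
  by rewrite Zv (Hs0 (time_interval_sub hT Tt _ st)) subr0 mxE expr0n.
Qed.

End processes.

(** * Measurability of portfolio values and of the exchange strategy *)

Section measurability.
Context {d : measure_display} {V : measurableType d} {R : realType} (D : set V).

Lemma measurable_fun_mulmx {n : nat} (b : V -> 'rV[R]_n) (s : V -> 'cV[R]_n) :
  (forall j, measurable_fun D (fun v => b v 0 j)) ->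
  (forall j, measurable_fun D (fun v => s v j 0)) ->
  measurable_fun D (fun v => (b v *m s v) 0 0).
Proof.
move=> mb ms; under eq_fun do rewrite mxE.
by apply: measurable_sum => j; exact: measurable_funM.
Qed.

(** This is the arbitrage candidate over an arbitrary measurable space: taken over [F t] it gives
    adaptedness, taken over the product with [T] it gives joint measurability. *)
Lemma measurable_fun_exchange {n : nat} (r : V -> R) (b c : V -> 'rV[R]_n)
    (s : V -> 'cV[R]_n) (j : 'I_n) :
  measurable_fun D r ->
  (forall j, measurable_fun D (fun v => b v 0 j)) ->
  (forall j, measurable_fun D (fun v => c v 0 j)) ->
  (forall j, measurable_fun D (fun v => s v j 0)) ->
  measurable_fun D (fun v =>
    (r v *: ((c v *m s v) 0 0 *: b v - (b v *m s v) 0 0 *: c v)) 0 j).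
Proof.
move=> mr mb mc ms; under eq_fun do rewrite !mxE.
apply: measurable_funM => //; apply: measurable_funB; apply: measurable_funM => //;
  apply: measurable_sum => k; exact: measurable_funM.
Qed.

End measurability.

(** * The drift of a money market account *)

Section market.
Context {R : realType} {d : measure_display} {Omega : measurableType d}
  {P : probability Omega R} (hP : measure_is_complete P)
  {T : set R} (hT : time_interval T)
  {F : R -> set_system Omega} (hF : filtration T F) {K N : nat}
  {W : R -> Omega -> 'cV[R]_K}
  {S mu : R -> Omega -> 'cV[R]_N.+1} {sigma : R -> Omega -> 'M[R]_(N.+1, K)}
  (mS : entrywise (measurable_process T) S).
Local Notation leb := (@lebesgue_measure R).

Lemma measurable_process_preimage (X : R -> Omega -> R) (B : set R) :
  measurable_process T X -> measurable B ->
  measurable [set p : Omega * R | T p.2 /\ B (X p.2 p.1)].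
Proof.
move=> mX mB; have mT := measurable_time_interval hT.
rewrite (_ : [set p | _] = ([set: Omega] `*` T) `&`
    (fun p : Omega * R => X p.2 p.1) @^-1` B).
  by apply: mX => //; exact: measurableX.
by apply/seteqP; split=> -[w t] /= [] => [|[]].
Qed.

Lemma ae_process_of_path (X : R -> Omega -> R) (B : set R) :
  measurable_process T X -> measurable B ->
  (\forall w \ae P, \forall t \ae leb, T t -> B (X t w)) ->
  ae_process P T (fun t w => B (X t w)).
Proof.
move=> mX mB; apply: (@ae_product_of_xsection _ _ _ _ _ P leb
  (fun w t => T t -> B (X t w))).
rewrite (_ : [set p | _] = ~` [set p : Omega * R | T p.2 /\ (~` B) (X p.2 p.1)]).
  by apply: measurableC; apply: measurable_process_preimage => //; exact: measurableC.
apply/seteqP; split=> -[w t] /= h; first by case=> /h.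
by move=> Tt; apply: contrapT => nB; exact: h.
Qed.

Lemma measurable_value_process {b : R -> Omega -> 'rV[R]_N.+1} :
  trading_strategy T F b -> measurable_process T (value_process S b).
Proof.
move=> [_ mb]; apply: measurable_fun_mulmx => j; [exact: mb|exact: mS].
Qed.

Lemma money_market_drift {b : R -> Omega -> 'rV[R]_N.+1} {r : R -> Omega -> R} :
  money_market_account P T F W S mu sigma b ->
  interest_rate_process P T F S b r ->
  ae_process P T (fun t w => gains_drift mu b t w =
    r t w * value_process S b t w).
Proof.
move=> [[[tsb [_ ma intga] _] [_ Hs [A [I [[_ _ AE] sI ME]]]]] _ [_ H0]].
move=> [[_ mr intr] [Ar [_ _ ArE] MrE]].
have I0 : indistinguishable P T I (fun _ _ => 0).
  by apply: stochastic_integral_ae0 sI => // i j; have [] := Hs i j.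
have [u [uT Tu]] := time_interval_exhaustion hT.
(* Writing the equality as membership of a difference in a measurable set puts it in the form that
   [ae_process_of_path] accepts. *)
suff : ae_process P T (fun t w =>
    [set 0] (gains_drift mu b t w - r t w * value_process S b t w)).
  by apply: aeS => -[w t] /= h /h /eqP; rewrite subr_eq0 => /eqP.
apply: (ae_process_of_path
    (fun t w => gains_drift mu b t w - r t w * value_process S b t w)) => //.
  apply: measurable_funB => //.
  by apply: measurable_funM => //; exact: measurable_value_process.
have := aeI intga (aeI intr (aeI AE (aeI ArE
  (aeI ME (aeI I0 MrE))))).
apply: aeS => w [intgaw [intrw [AEw [ArEw [MEw [I0w MrEw]]]]]].
(* On one good path, the Itô form without its [dW] term and the exponential form of the value are
   compared on each []0, u n[], with the initial value as the constant [c]. *)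
have aen : \forall t \ae leb, forall n, t \in `]0, u n[ ->
    gains_drift mu b t w = value_process S b 0 w *
      expR (\int[leb]_(s in `[0, t]) r s w) * r t w.
  apply: ae_foralln => n; have [un0 Tun] := uT n.
  apply: (expR_Rintegral_ae (r^~ w)).
  - exact: intrw.
  - exact: intgaw.
  - move=> t tn; have Tt : T t.
      by apply: (time_interval_sub hT Tun); exact: subset_itv_oo_cc.
    by rewrite -ArEw// -MrEw// MEw// I0w// addr0 AEw.
apply: aeS (aeI aen (time_interval_interior_ae u Tu)) => t [tn tI] Tt.
have [n /tn ->] := tI Tt.
apply/eqP; rewrite subr_eq0; apply/eqP.
by rewrite -ArEw// -MrEw// mulrC.
Qed.

End market.

(** * Equality of the interest rates and of the normalised accounts *)

Theorem proposition1 (R : realType) (d : measure_display)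
    (Omega : measurableType d) (P : probability Omega R)
    (hP : measure_is_complete P)
    (T : set R) (hT : time_interval T)
    (F : R -> set_system Omega) (hF : filtration T F)
    (K N : nat)
    (W : R -> Omega -> 'cV[R]_K) (hW : wiener_process P T F W)
    (S D mu : R -> Omega -> 'cV[R]_N.+1)
    (sigma : R -> Omega -> 'M[R]_(N.+1, K))
    (hSD : securities_market_model P T F W S D mu sigma)
    (hNA : inst_arbitrage_free P T F S mu sigma)
    (b1 b2 : R -> Omega -> 'rV[R]_N.+1) (r1 r2 : R -> Omega -> R)
    (hb1 : money_market_account P T F W S mu sigma b1)
    (hb2 : money_market_account P T F W S mu sigma b2)
    (hr1 : interest_rate_process P T F S b1 r1)
    (hr2 : interest_rate_process P T F S b2 r2) :
  ae_process P T (fun t w => r1 t w = r2 t w) /\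
  indistinguishable P T
    (fun t w => value_process S b1 t w / value_process S b1 0 w)
    (fun t w => value_process S b2 t w / value_process S b2 0 w).
Proof.
pose leb := @lebesgue_measure R.
have [[aS mS] _ _ _] := hSD.
have [[[ts1 [_ ma1 _] _] _] pos1 [_ s1]] := hb1.
have [[[ts2 [_ ma2 _] _] _] pos2 [_ s2]] := hb2.
have [[ar1 mr1 intr1] [A1 [_ _ A1E] M1E]] := hr1.
have [[ar2 mr2 intr2] [A2 [_ _ A2E] M2E]] := hr2.
have a1E := money_market_drift hP hT hF mS hb1 hr1.
have a2E := money_market_drift hP hT hF mS hb2 hr2.
have mM1 := measurable_value_process mS ts1.
have mM2 := measurable_value_process mS ts2.
(* Going long [b1] and short [b2] at equal value has drift (r1 - r2) M1 M2; the extra factor r1 - r2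
   makes it a square, which avoids splitting on the sign. *)
pose Delta t w := (r1 t w - r2 t w) *:
  (value_process S b2 t w *: b1 t w - value_process S b1 t w *: b2 t w).
have driftE t w : gains_drift mu Delta t w = (r1 t w - r2 t w) *
    (value_process S b2 t w * gains_drift mu b1 t w -
     value_process S b1 t w * gains_drift mu b2 t w).
  by rewrite /gains_drift /Delta -scalemxAl mulmxBl -!scalemxAl !mxE.
have valueE t w : value_process S Delta t w = 0.
  transitivity ((r1 t w - r2 t w) *
    (value_process S b2 t w * value_process S b1 t w -
     value_process S b1 t w * value_process S b2 t w)); last by ring.
  by rewrite [LHS]/value_process /Delta -scalemxAl mulmxBl -!scalemxAl !mxE
    /value_process !mxE.
have tsD : trading_strategy T F Delta.
  split=> [i j t Tt|i j].
    have [/(_ t Tt) sF _ _] := hF.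
    rewrite ord1; apply/(rv_measurable_fun _ _ sF).
    apply: (@measurable_fun_exchange _ (g_sigma_algebraType (F t)) R setT _
      (fun w => r1 t w - r2 t w) (b1 t) (b2 t) (S t) j).
    - by apply: measurable_funB; apply/(rv_measurable_fun _ _ sF); [exact: ar1|exact: ar2].
    - by move=> k; apply/(rv_measurable_fun _ _ sF); exact: ts1.1.
    - by move=> k; apply/(rv_measurable_fun _ _ sF); exact: ts2.1.
    - by move=> k; apply/(rv_measurable_fun _ _ sF); exact: aS.
  rewrite ord1; apply: (@measurable_fun_exchange _ _ R _ _
    (fun p => r1 p.2 p.1 - r2 p.2 p.1) (fun p => b1 p.2 p.1)
    (fun p => b2 p.2 p.1) (fun p => S p.2 p.1) j).
  - exact: measurable_funB.
  - by move=> k; exact: ts1.2.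
  - by move=> k; exact: ts2.2.
  - by move=> k; exact: mS.
have pos_ae b : trading_strategy T F b ->
    (\forall w \ae P, forall t, T t -> 0 < value_process S b t w) ->
    ae_process P T (fun t w => 0 < value_process S b t w).
  move=> tsb posb.
  suff : ae_process P T (fun t w => value_process S b t w \in `]0, +oo[).
    by apply: aeS => p h /h; rewrite in_itv/= andbT.
  apply: (ae_process_of_path hT (value_process S b) `]0, +oo[) => //.
    exact: (measurable_value_process mS tsb).
  apply: aeS posb => w posw; apply: aeW => t Tt.
  by rewrite /= in_itv/= andbT posw.
have drift_ae : ae_process P T (fun t w => 0 < value_process S b1 t w /\
    0 < value_process S b2 t w /\ gains_drift mu Delta t w =
    (r1 t w - r2 t w) ^+ 2 * (value_process S b1 t w * value_process S b2 t w)).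
  have := aeI a1E (aeI a2E (aeI (pos_ae _ ts1 pos1) (pos_ae _ ts2 pos2))).
  apply: aeS => -[w t] /= [h1 [h2 [p1 p2]]] Tt.
  split; [exact: p1|split; first exact: p2].
  by rewrite driftE h1// h2//; ring.
have r12 : ae_process P T (fun t w => r1 t w = r2 t w).
  apply: contrapT => nr12; apply: hNA; exists Delta; split.
  - split=> //; apply: aeS (aeI s1 s2) => -[w t] /= [h1 h2] Tt.
    move: (h1 Tt) (h2 Tt); rewrite /gains_dispersion/= => s1tw s2tw.
    by rewrite -scalemxAl mulmxBl -!scalemxAl s1tw s2tw !scaler0 subr0 scaler0.
  - by apply: aeW => p _.
  - apply: aeS drift_ae => -[w t] /= h Tt; have [p1 [p2 ->]] := h Tt.
    by rewrite mulr_ge0 ?sqr_ge0// mulr_ge0 ?ltW.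
  (* If the drift were positive only on a null set, then, M1 and M2 being positive, (r1 - r2)^2
     would vanish almost everywhere, against [nr12]. *)
  - rewrite /positive_measure lt0e measure_ge0 andbT; apply/eqP => D0.
    apply: nr12.
    have : \forall p \ae (P \x leb)%E, ~ (T p.2 /\ 0 < gains_drift mu Delta p.2 p.1).
      exists [set p | T p.2 /\ 0 < gains_drift mu Delta p.2 p.1].
      split => //; last by move=> p /contrapT.
      rewrite (_ : [set p | _] = [set p : Omega * R |
          T p.2 /\ gains_drift mu Delta p.2 p.1 \in `]0, +oo[]).
        apply: (measurable_process_preimage hT (gains_drift mu Delta) `]0, +oo[) => //.
        rewrite /measurable_process (_ : (fun p : Omega * R => _) = fun p =>
          (r1 p.2 p.1 - r2 p.2 p.1) *
          (value_process S b2 p.2 p.1 * gains_drift mu b1 p.2 p.1 -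
           value_process S b1 p.2 p.1 * gains_drift mu b2 p.2 p.1)); last first.
          by apply/funext => p; exact: driftE.
        apply: measurable_funM; first exact: measurable_funB.
        by apply: measurable_funB; apply: measurable_funM.
      by apply/funext => p; rewrite /= in_itv/= andbT.
    move=> nD; apply: aeS (aeI drift_ae nD) => -[w t] /= [h {}nD] Tt; have [p1 [p2 dE]] := h Tt.
    apply/eqP; rewrite -subr_eq0; apply/negPn/negP => r0; apply: nD; split => //.
    by rewrite dE mulr_gt0 ?exprn_even_gt0// mulr_gt0.
split=> //.
(* Back to paths: almost surely the rates agree at almost all times, hence have equal time integrals
   at every t in [T]. *)
have := @ae_product_xsection _ _ _ _ _ P leb (fun w t => T t -> r1 t w = r2 t w) r12.
move=> r12w; have := aeI r12w (aeI A1E (aeI A2E (aeI M1E (aeI M2E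
  (aeI pos1 (aeI pos2 (aeI intr1 intr2))))))).
apply: aeS => w [r12' [A1w [A2w [M1w [M2w [p1 [p2 [i1 i2]]]]]]]] t Tt.
have T0 := time_interval0 hT.
(* Positivity at time 0 allows cancelling the initial values, which leaves the two exponentials. *)
rewrite M1w// M2w// mulrAC mulfV ?gt_eqF ?p1// mulrAC mulfV ?gt_eqF ?p2//.
rewrite A1w// A2w//; congr (_ * expR (fine _)).
have /integrableP[m1 _] := i1 _ Tt; have /integrableP[m2 _] := i2 _ Tt.
apply: ae_eq_integral => //.
apply: aeS r12' => s rs st; congr EFin; apply: rs.
exact: (time_interval_sub hT Tt).
Qed.
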